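(* Let $n\ge2$ and let $C=\{x\in\mathbb{Z}_2^n: Ax\equiv b\}$ be a (nonempty) coset in $\mathbb{Z}_2^n$, for some $A\in\mathbb{Z}_2^{k\times n}$ and $b\in\mathbb{Z}_2^k$. Then $$M(C)=|C|\,\min\left(\frac{M(C_I)+M(C_J)}{|C_I|\,|C_J|}\right),$$ where the minimum is over nontrivial partitions $(I,J)$ of $\{1,\dots,n\}$ (that is, $I$ and $J$ both nonempty).
   Context: For $S\subseteq\{0,1\}^m$ nonempty, $|S\rangle=\frac1{\sqrt{|S|}}\sum_{x\in S}|x\rangle$ and $M(S)=\mathrm{MOTS}(|S\rangle)$, the manifestly orthogonal tree size, defined below. Given a coset $C$ in $\mathbb{Z}_2^n$ and a nontrivial partition $(I,J)$ of $\{1,\dots,n\}$, there exist distinct cosets $C_I^{(1)},\dots,C_I^{(H)}$ in $\mathbb{Z}_2^{I}$ and distinct cosets $C_J^{(1)},\dots,C_J^{(H)}$ in $\mathbb{Z}_2^{J}$ such that $C=\bigcup_{h=1}^H C_I^{(h)}\otimes C_J^{(h)}$, where $C_I^{(h)}\otimes C_J^{(h)}$ denotes the set of strings whose restriction to $I$ lies in $C_I^{(h)}$ and whose restriction to $J$ lies in $C_J^{(h)}$; these are unique up to ordering, and the quantities $|C_I^{(h)}|$, $|C_J^{(h)}|$, $M(C_I^{(h)})$, $M(C_J^{(h)})$ do not depend on $h$. They are denoted $|C_I|,|C_J|,M(C_I),M(C_J)$. A quantum state tree over $(\mathbb{C}^2)^{\otimes n}$ is a rooted tree in which each leaf is labeled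 with $\alpha|0\rangle+\beta|1\rangle$ for some $\alpha,\beta\in\mathbb{C}$, each non-leaf vertex (gate, of arbitrary fan-in) is labeled with $+$ or $\otimes$, and each vertex $v$ is labeled with a set $S(v)\subseteq\{1,\dots,n\}$ (of qubits) such that: (i) $|S(v)|=1$ if $v$ is a leaf; (ii) $S(v)=\{1,\dots,n\}$ if $v$ is the root; (iii) if $v$ is a $+$ gate and $w$ is a child of $v$ then $S(w)=S(v)$; (iv) if $v$ is a $\otimes$ gate with children $w_1,\dots,w_k$ then $S(w_1),\dots,S(w_k)$ form a partition of $S(v)$. The outgoing edges of each $+$ gate are labeled with complex numbers. The subtree at $v$ represents a state of the qubits in $S(v)$ in the obvious way (linear combination with edge labels as coefficients, respectively tensor product), required to be normalized for every $v$. The tree is manifestly orthogonal if for every $+$ gate and any two of its children, representing $|\psi_1\rangle,|\psi_2\rangle$, every basis state $|x\rangle$ has $\langle\psi_1|x\rangle=0$ or $\langle\psi_2|x\rangle=0$. $\mathrm{MOTS}(|\psi\rangle)$ is the minimum number of leaves of a manifestly orthogonal tree representing $|\psi\rangle$. *)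

(* Defs.v *)
From mathcomp Require Import all_boot all_order all_algebra.
From mathcomp Require Import boolp reals.
From mathcomp.real_closed Require Export complex.

Set Implicit Arguments.
Unset Strict Implicit.
Unset Printing Implicit Defensive.

Import Order.TTheory GRing.Theory Num.Theory.
Local Open Scope ring_scope.

(* Qubits are indexed by 'I_n.  For I : {set 'I_n}, the group Z_2^I is encoded
   as the coordinate subspace [bits_on I] of Z_2^n = 'cV['F_2]_n, i.e. the
   strings that vanish outside I.  Accordingly a state of the qubits in I is a
   function on 'cV['F_2]_n of which only the values (amplitudes) on [bits_on I]
   are meaningful. *)

Notation bits n := 'cV['F_2]_n.

Section Strings.
Variable n : nat.
Implicit Types (I J : {set 'I_n}) (x : bits n).

Definition bits_on I : {set bits n} :=
  [set x : bits n | [forall i, (i \notin I) ==> (x i 0 == 0)]].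

Definition restr I x : bits n := \col_i (if i \in I then x i 0 else 0).

Definition solutions k (A : 'M['F_2]_(k, n)) (b : 'cV['F_2]_k) : {set bits n} :=
  [set x : bits n | A *m x == b].

Definition is_coset I (S : {set bits n}) : Prop :=
  S != set0 /\
  exists k (A : 'M['F_2]_(k, n)) (b : 'cV['F_2]_k),
    S = bits_on I :&: solutions A b.

Definition tensor_set I J (SI SJ : {set bits n}) : {set bits n} :=
  [set x in bits_on (I :|: J) | (restr I x \in SI) && (restr J x \in SJ)].

Definition nontrivial_partition I J : Prop :=
  [/\ I != set0, J != set0, [disjoint I & J] & I :|: J = [set: 'I_n]].

(* The cosets C_I^(h) (resp. C_J^(h)) are required to be pairwise disjoint, not
   merely pairwise different: this is what makes them unique up to ordering.
   For instance {0,1}^2 is also the union of {0} x {0,1}, {1} x {0} and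
   {0,1} x {1}. *)
Definition coset_decomposition (C : {set bits n}) I J H
    (CI CJ : 'I_H -> {set bits n}) : Prop :=
  [/\ forall h, is_coset I (CI h) /\ is_coset J (CJ h),
      forall h h', h != h' -> [disjoint CI h & CI h'],
      forall h h', h != h' -> [disjoint CJ h & CJ h']
    & C = \bigcup_(h < H) tensor_set I J (CI h) (CJ h)].

End Strings.

Section Trees.
Variables (R : realType) (n : nat).
Local Notation CC := R[i].

Definition indexed_partition k (P : 'I_k -> {set 'I_n}) (S : {set 'I_n}) : Prop :=
  [/\ forall j, P j != set0,
      forall i j, i != j -> [disjoint P i & P j]
    & \bigcup_(j < k) P j = S].

(* [qtree S] is the type of trees whose root is labeled with S; gates have an
   arbitrary positive fan-in k.+1.  [Leaf q _ a b] is labeled with a|0> + b|1>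
   on the qubit q, and w j is the label of the edge to the j-th child. *)
Inductive qtree (S : {set 'I_n}) : Type :=
| Leaf (q : 'I_n) of S = [set q] & CC & CC
| Plus (k : nat) (w : 'I_k.+1 -> CC) (t : 'I_k.+1 -> qtree S)
| Tensor (k : nat) (P : 'I_k.+1 -> {set 'I_n}) of indexed_partition P S
         & (forall j, qtree (P j)).

Fixpoint leaves S (t : qtree S) : nat :=
  match t with
  | Leaf _ _ _ _ => 1%N
  | Plus _ _ t => (\sum_j leaves (t j))%N
  | Tensor _ _ _ t => (\sum_j leaves (t j))%N
  end.

(* The amplitude <x|t>.  It only depends on the coordinates of x in S, so that
   in the tensor case x stands for its restriction to P j. *)
Fixpoint amp S (t : qtree S) (x : bits n) : CC :=
  match t with
  | Leaf q _ a b => if x q 0 == 0 then a else b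
  | Plus _ w t => \sum_j w j * amp (t j) x
  | Tensor _ _ _ t => \prod_j amp (t j) x
  end.

Definition unit_norm (S : {set 'I_n}) (psi : bits n -> CC) : Prop :=
  \sum_(x in bits_on S) `|psi x| ^+ 2 = 1.

Fixpoint normalized S (t : qtree S) : Prop :=
  unit_norm S (amp t) /\
  match t with
  | Leaf _ _ _ _ => True
  | Plus _ _ t => forall j, normalized (t j)
  | Tensor _ _ _ t => forall j, normalized (t j)
  end.

Fixpoint manifestly_orthogonal S (t : qtree S) : Prop :=
  match t with
  | Leaf _ _ _ _ => True
  | Plus _ _ t =>
      (forall i j, i != j -> forall x, x \in bits_on S ->
         amp (t i) x = 0 \/ amp (t j) x = 0) /\
      forall j, manifestly_orthogonal (t j)
  | Tensor _ _ _ t => forall j, manifestly_orthogonal (t j)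
  end.

Definition represents S (t : qtree S) (psi : bits n -> CC) : Prop :=
  forall x, x \in bits_on S -> amp t x = psi x.

Definition has_mo_tree_of_size (S : {set 'I_n}) (psi : bits n -> CC) (m : nat) : Prop :=
  exists t : qtree S,
    [/\ normalized t, manifestly_orthogonal t, represents t psi & leaves t = m].

(* The value 0 is a dummy, for functions psi that no tree represents (such as
   those that are not normalized). *)
Definition MOTS (S : {set 'I_n}) (psi : bits n -> CC) : nat :=
  match pselect (exists m, `[< has_mo_tree_of_size S psi m >]) with
  | left ex => ex_minn ex
  | right _ => 0%N
  end.

Definition uniform_state (X : {set bits n}) (x : bits n) : CC :=
  if x \in X then (sqrtC #|X|%:R)^-1 else 0.

Definition M (S : {set 'I_n}) (X : {set bits n}) : nat := MOTS S (uniform_state X).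

(* v is the value of (M(C_I) + M(C_J)) / (|C_I| |C_J|) for some nontrivial
   partition (I, J); by the uniqueness of the decomposition and the
   independence of h, each (I, J) contributes a single value. *)
Definition partition_ratio (C : {set bits n}) (v : R) : Prop :=
  exists (I J : {set 'I_n}) (H : nat) (CI CJ : 'I_H -> {set bits n}) (h : 'I_H),
    [/\ nontrivial_partition I J,
        coset_decomposition C I J CI CJ
      & v = (M I (CI h) + M J (CJ h))%:R / (#|CI h|%:R * #|CJ h|%:R)].

End Trees.

Definition is_minimum (R : realType) (E : R -> Prop) (v : R) : Prop :=
  E v /\ forall u, E u -> v <= u.

(* Main.v *)
(* Taking supports turns a manifestly orthogonal tree for a state with support S
   into a way of building S from sets of one-bit strings by disjoint unions and
   tensor products, and every such way gives a tree for the uniform state on S.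
   Hence M(S) is the least number of leaves in such a construction.

   Upper bound: C is the disjoint union of H = |C| / (|C_I| |C_J|) products,
   all translates of one another, and translations do not change M.
   Lower bound: if phi is at most all the ratios (M(C_I) + M(C_J)) / (|C_I| |C_J|),
   then by induction a construction of any subset X of C has at least phi |X|
   leaves.  Unions are clear by additivity.  If X = Y (x) Z, then Y and Z lie in
   some C_I and C_J, with densities p, q <= 1.  Applying the induction hypothesis
   to C_I with phi := M(C_I) / |C_I|, a legitimate choice by the upper bound,
   and likewise to C_J, gives at least
   p M(C_I) + q M(C_J) >= p q (M(C_I) + M(C_J)) >= phi |X| leaves. *)
Require Import Defs.
From HB Require Import structures.
From mathcomp Require Import all_boot all_order all_algebra.
From mathcomp Require Import boolp reals.
Import Order.TTheory GRing.Theory Num.Theory.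
Local Open Scope ring_scope.

Set Implicit Arguments.
Unset Strict Implicit.
Unset Printing Implicit Defensive.

(** * Finite sets *)

Lemma bigcup_singletons (T : finType) (A : {set T}) : \bigcup_(x in A) [set x] = A.
Proof.
apply/setP => x; apply/bigcupP/idP => [[y yA /set1P->//]|xA].
by exists x; rewrite ?set11.
Qed.

(** The induction starts at singletons because [set_tree_size] admits neither an empty union nor an
    empty tensor product. *)
Lemma nonempty_set_ind (T : finType) (Q : {set T} -> Prop) :
  (forall i, Q [set i]) ->
  (forall i (D : {set T}), i \notin D -> D != set0 -> Q D -> Q (i |: D)) ->
  forall D, D != set0 -> Q D.
Proof.
move=> Q1 QU D; have [k] := ubnP #|D|; elim: k D => // k IHk D.
rewrite ltnS => leDk /set0Pn[i Di]; rewrite -(setD1K Di).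
have [->|D'0] := eqVneq (D :\ i) set0; first by rewrite setU0.
apply: QU => //; first by rewrite !inE eqxx.
by apply: IHk => //; move: leDk; rewrite (cardsD1 i) Di.
Qed.

(** * Strings, restrictions and products of sets *)

Section Strings.
Variable n : nat.
Implicit Types (I J K : {set 'I_n}) (x y z t : bits n) (X Y C : {set bits n}).

Lemma bits_onP I x :
  reflect (forall i, i \notin I -> x i 0 = 0) (x \in bits_on I).
Proof.
rewrite inE; apply: (iffP forallP) => [h i|h i].
  by move=> iI; apply/eqP; apply: (implyP (h i)).
by apply/implyP => /h ->.
Qed.

Lemma bits_onT : bits_on [set: 'I_n] = setT.
Proof. by apply/setP => x; rewrite in_setT; apply/bits_onP => i; rewrite in_setT. Qed.

Lemma bits_onS I J : I \subset J -> bits_on I \subset bits_on J.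
Proof.
move=> /subsetP sIJ; apply/subsetP => x /bits_onP xI; apply/bits_onP => i.
by move=> iJ; apply: xI; apply: contra iJ; apply: sIJ.
Qed.

Lemma bits_onB I x y : x \in bits_on I -> y \in bits_on I -> x - y \in bits_on I.
Proof.
move=> /bits_onP xI /bits_onP yI; apply/bits_onP => i iI.
by rewrite !mxE xI ?yI // subr0.
Qed.

Lemma bits_onD I x y : x \in bits_on I -> y \in bits_on I -> x + y \in bits_on I.
Proof.
move=> /bits_onP xI /bits_onP yI; apply/bits_onP => i iI.
by rewrite !mxE xI ?yI // addr0.
Qed.

Lemma restr_is_zmod_morphism I : zmod_morphism (@restr n I).
Proof.
by move=> x y; apply/matrixP => i j; rewrite !mxE; case: ifP => // _; rewrite subr0.
Qed.

HB.instance Definition _ I :=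
  GRing.isZmodMorphism.Build _ _ (@restr n I) (restr_is_zmod_morphism I).

Lemma restr_on I x : restr I x \in bits_on I.
Proof. by apply/bits_onP => i /negPf iI; rewrite mxE iI. Qed.

Lemma restr_id I x : x \in bits_on I -> restr I x = x.
Proof.
move=> /bits_onP xI; apply/matrixP => i j; rewrite mxE (ord1 j).
by case: ifPn => // /xI ->.
Qed.

Lemma restr_eq0 I J x : [disjoint I & J] -> x \in bits_on J -> restr I x = 0.
Proof.
move=> dIJ /bits_onP xJ; apply/matrixP => i j; rewrite !mxE.
by case: ifP => // iI; apply: xJ; rewrite (disjointFr dIJ).
Qed.

Lemma restr_restr I J x : I \subset J -> restr I (restr J x) = restr I x.
Proof.
move=> /subsetP sIJ; apply/matrixP => i j; rewrite !mxE.
by case: ifP => // /sIJ ->.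
Qed.

Lemma restrU I J x : [disjoint I & J] -> restr (I :|: J) x = restr I x + restr J x.
Proof.
move=> dIJ; apply/matrixP => i j; rewrite !mxE inE.
case iI: (i \in I) => /=; last by rewrite add0r.
by rewrite (disjointFr dIJ iI) addr0.
Qed.

Lemma restrD I J y z : [disjoint I & J] -> y \in bits_on I -> z \in bits_on J ->
  restr I (y + z) = y /\ restr J (y + z) = z.
Proof.
move=> dIJ yI zJ; rewrite !raddfD /= (restr_id yI) (restr_id zJ).
rewrite (restr_eq0 dIJ zJ) (restr_eq0 _ yI) ?addr0 ?add0r //.
by rewrite disjoint_sym.
Qed.

Lemma onU_add I J y z : y \in bits_on I -> z \in bits_on J ->
  y + z \in bits_on (I :|: J).
Proof.
by move=> yI zJ; apply: bits_onD; [move: yI|move: zJ];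
  apply/subsetP/bits_onS; rewrite ?subsetUl ?subsetUr.
Qed.

Lemma in_tensor I J X Y x : (x \in tensor_set I J X Y) =
  [&& x \in bits_on (I :|: J), restr I x \in X & restr J x \in Y].
Proof. by rewrite in_set. Qed.

Lemma tensor_setC I J X Y : tensor_set I J X Y = tensor_set J I Y X.
Proof. by apply/setP => x; rewrite !inE setUC [_ && (_ \in Y)]andbC. Qed.

Lemma mem_tensorD I J X Y y z : [disjoint I & J] ->
  y \in bits_on I -> z \in bits_on J ->
  (y + z \in tensor_set I J X Y) = (y \in X) && (z \in Y).
Proof.
move=> dIJ yI zJ; have [ry rz] := restrD dIJ yI zJ.
by rewrite in_tensor (onU_add yI zJ) ry rz.
Qed.

Lemma tensor_sub I J X Y : tensor_set I J X Y \subset bits_on (I :|: J).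
Proof. by apply/subsetP => x; rewrite in_tensor => /andP[]. Qed.

(** The map [(y, z) |-> y + z] is a bijection from [setX X Y] onto the product; the two restrictions
    invert it. *)
Lemma card_tensor I J X Y : [disjoint I & J] ->
  X \subset bits_on I -> Y \subset bits_on J ->
  #|tensor_set I J X Y| = (#|X| * #|Y|)%N.
Proof.
move=> dIJ /subsetP XI /subsetP YJ; rewrite -cardsX.
have inj : {in setX X Y &, injective (fun p : bits n * bits n => p.1 + p.2)}.
  move=> [y z] [y' z'] /setXP[/XI yI /YJ zJ] /setXP[/XI yI' /YJ zJ'] /= e.
  have [ry rz] := restrD dIJ yI zJ; have [ry' rz'] := restrD dIJ yI' zJ'.
  by congr (_, _); [rewrite -ry e|rewrite -rz e].
rewrite -(card_in_imset inj); apply: eq_card => x; apply/idP/imsetP.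
  rewrite in_tensor => /and3P[xU xX xY].
  exists (restr I x, restr J x); first by rewrite in_setX xX.
  by rewrite /= -restrU // restr_id.
by move=> [[y z] /setXP[yX zY] ->] /=; rewrite mem_tensorD ?XI ?YJ ?yX.
Qed.

(* "At most m leaves": slack is allowed in the leaves, so that children of a +
   gate whose edge is labeled with 0 can be dropped. *)
Inductive set_tree_size : {set 'I_n} -> {set bits n} -> nat -> Prop :=
| Set_leaf q X m of X \subset bits_on [set q] & X != set0 & (0 < m)%N :
    set_tree_size [set q] X m
| Set_union I X Y a b of [disjoint X & Y] &
    set_tree_size I X a & set_tree_size I Y b : set_tree_size I (X :|: Y) (a + b)
| Set_tensor I J X Y a b of [disjoint I & J] &
    set_tree_size I X a & set_tree_size J Y b :
    set_tree_size (I :|: J) (tensor_set I J X Y) (a + b).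

(** * Constructions by disjoint unions and tensor products *)

Lemma set_tree_proper I X m : set_tree_size I X m ->
  [/\ I != set0, X != set0 & X \subset bits_on I].
Proof.
elim=> {I X m} [q X m XI X0 _|I X Y a b _ _ [I0 X0 XI] _ [_ _ YI]|].
- split=> //; apply/set0Pn; exists q; exact: set11.
- by split; rewrite ?setU_eq0 ?negb_and ?X0 // subUset XI.
move=> I J X Y a b dIJ _ [I0 X0 XI] _ [J0 Y0 YJ]; split.
- by rewrite setU_eq0 negb_and I0.
- by rewrite -cards_eq0 card_tensor // muln_eq0 !cards_eq0 negb_or X0.
- exact: tensor_sub.
Qed.

(** The surplus is pushed into the first component of each gate until it reaches a leaf, where slack
    is allowed. *)
Lemma set_tree_weaken I X a b :
  set_tree_size I X a -> (a <= b)%N -> set_tree_size I X b.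
Proof.
move=> tX; elim: tX b => {I X a} [q X m XI X0 m0 b mb||].
- by apply: Set_leaf => //; apply: leq_trans mb.
- move=> I X Y a b dXY _ IHX tY IHY c leabc.
  by rewrite -(subnKC leabc) addnAC; apply: Set_union => //; apply: IHX; apply: leq_addr.
move=> I J X Y a b dXY _ IHX tY IHY c leabc.
by rewrite -(subnKC leabc) addnAC; apply: Set_tensor => //; apply: IHX; apply: leq_addr.
Qed.

Lemma set_tree_bigcup (T : finType) I (D : {set T}) (F : T -> {set bits n}) c :
    D != set0 -> (forall i, i \in D -> set_tree_size I (F i) (c i)) ->
    (forall i j, i != j -> [disjoint F i & F j]) ->
  set_tree_size I (\bigcup_(i in D) F i) (\sum_(i in D) c i).
Proof.
move=> D0 tF dF; elim/nonempty_set_ind: D0 tF => [i tF|i {}D iD _ IH tF].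
  by rewrite !big_set1; apply: tF; rewrite set11.
rewrite !big_setU1 //=; apply: Set_union; last first.
- by apply: IH => j jD; apply: tF; rewrite setU1r.
- by apply: tF; rewrite setU11.
apply/pred0P => x /=; apply/negbTE/andP=> -[xi /bigcupP[j jD xj]].
have ij : i != j by apply: contraNneq iD => ->.
by move: (disjointFr (dF _ _ ij) xi); rewrite xj.
Qed.

Lemma set_tree_bigtensor (T : finType) (D : {set T}) (P : T -> {set 'I_n})
      (F : T -> {set bits n}) c :
    D != set0 -> (forall i, set_tree_size (P i) (F i) (c i)) ->
    (forall i j, i != j -> [disjoint P i & P j]) ->
  set_tree_size (\bigcup_(i in D) P i)
    [set x in bits_on (\bigcup_(i in D) P i) |
      [forall i in D, restr (P i) x \in F i]]
    (\sum_(i in D) c i).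
Proof.
move=> D0 tF dP; elim/nonempty_set_ind: D0 => [i|i {}D iD _ IH].
  rewrite !big_set1; have [_ _ FP] := set_tree_proper (tF i).
  rewrite [X in set_tree_size _ X _](_ : _ = F i) //; apply/setP => x.
  rewrite in_set; apply/andP/idP => [[xP /forallP/(_ i)]|xF].
    by rewrite set11 restr_id.
  have xP := subsetP FP _ xF; split=> //; apply/forallP => j; apply/implyP.
  by rewrite in_set1 => /eqP->; rewrite restr_id.
rewrite !big_setU1 //=; set U := \bigcup_(j in D) P j in IH *.
have dU : [disjoint P i & U].
  apply/pred0P => x /=; apply/negbTE/andP=> -[xi /bigcupP[j jD xj]].
  have ij : i != j by apply: contraNneq iD => ->.
  by move: (disjointFr (dP _ _ ij) xi); rewrite xj.
rewrite [X in set_tree_size _ X _](_ : _ = tensor_set (P i) U (F i)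
  [set x in bits_on U | [forall j in D, restr (P j) x \in F j]]).
  exact: Set_tensor.
(* Restriction to [P j] factors through restriction to [U], so the conditions indexed by [D] depend
   only on [restr U x]. *)
have sU j : j \in D -> P j \subset U by move=> jD; apply: bigcup_sup.
apply/setP => x; rewrite in_tensor [x \in [set _ | _]]in_set
  [restr U x \in _]in_set restr_on /=.
congr (_ && _); apply/forall_inP/andP => [h|[xi /forall_inP h] j].
  split; first by apply: h; rewrite setU11.
  by apply/forall_inP => j jD; rewrite restr_restr ?sU // h // setU1r.
by case/setU1P => [->//|jD]; rewrite -(restr_restr x (sU j jD)) h.
Qed.

(** A set is the disjoint union of its singletons, and a singleton is a tensor product of one-bit
    singletons. This guarantees that [MOTS] does not take its dummy value on uniform states. *)
Lemma set_tree_exists I X : I != set0 -> X != set0 -> X \subset bits_on I ->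
  exists m, set_tree_size I X m.
Proof.
move=> I0 X0 /subsetP XI.
suff [m tx] : exists m, forall x, x \in X -> set_tree_size I [set x] m.
  exists (\sum_(x in X) m)%N; rewrite -[Z in set_tree_size _ Z _]bigcup_singletons.
  by apply: set_tree_bigcup => // x y xy; rewrite disjoints1 in_set1.
exists (\sum_(i in I) 1)%N => x /XI xI.
have t1 i : set_tree_size [set i] [set restr [set i] x] 1.
  apply: Set_leaf => //; first by rewrite sub1set restr_on.
  by rewrite -card_gt0 cards1.
have := set_tree_bigtensor I0 t1; rewrite bigcup_singletons.
set T := [set _ in _ | _].
suff -> : T = [set x] by apply=> i j ij; rewrite disjoints1 in_set1.
apply/setP => y; rewrite in_set in_set1; apply/andP/eqP => [[yI /forall_inP h]|->].
  apply/matrixP => i j; rewrite (ord1 j).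
  have [iI|iI] := boolP (i \in I); last by rewrite (bits_onP _ _ xI) // (bits_onP _ _ yI).
  by have /set1P/matrixP/(_ i 0) := h _ iI; rewrite !mxE set11.
by split=> //; apply/forall_inP => i _; rewrite set11.
Qed.

(** Translation preserves disjoint unions, splits along tensor products into translations by the
    restrictions of [t], and sends leaves to leaves. *)
Lemma set_tree_translate I X m t : set_tree_size I X m -> t \in bits_on I ->
  set_tree_size I [set x | x + t \in X] m.
Proof.
have memT Z x u : (x \in [set y | y + u \in Z]) = (x + u \in Z) by rewrite in_set.
move=> tX; elim: tX t => {I X m} [q X m /subsetP XI X0 m0 t tI||].
- apply: Set_leaf => //.
    by apply/subsetP => x; rewrite in_set => /XI xt; rewrite -(addrK t x) bits_onB.
  by case/set0Pn: X0 => x xX; apply/set0Pn; exists (x - t); rewrite in_set subrK.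
- move=> I X Y a b dXY tX IHX tY IHY t tI.
  rewrite [X in set_tree_size _ X _](_ : _ =
    [set x | x + t \in X] :|: [set x | x + t \in Y]).
    apply: Set_union; [|exact: IHX|exact: IHY].
    by apply/pred0P => x /=; rewrite !memT; apply: (pred0P dXY).
  by apply/setP => x; rewrite in_setU !memT in_setU.
move=> I J X Y a b dIJ tX IHX tY IHY t tU.
rewrite [X in set_tree_size _ X _](_ : _ = tensor_set I J
    [set x | x + restr I t \in X] [set x | x + restr J t \in Y]).
  by apply: Set_tensor => //; [apply: IHX|apply: IHY]; apply: restr_on.
apply/setP => x; rewrite memT !in_tensor !memT !raddfD /=; congr (_ && _).
apply/idP/idP => [xt|xU]; last exact: bits_onD.
by rewrite -(addrK t x) bits_onB.
Qed.
End Strings.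

(** * Trees and the constructions of their supports *)

Section Trees.
Variables (R : realType) (n : nat).
Local Notation CC := R[i].
Implicit Types (I J S : {set 'I_n}) (x : bits n) (X Y : {set bits n}).

Definition amp_support S (t : qtree R S) : {set bits n} :=
  [set x in bits_on S | amp t x != 0].

Lemma in_amp_support S (t : qtree R S) x :
  (x \in amp_support t) = (x \in bits_on S) && (amp t x != 0).
Proof. by rewrite in_set. Qed.

(** A tensor gate evaluates its children at the whole string; this lets the support of a product be
    described by restrictions. *)
Lemma amp_restr S (t : qtree R S) x : amp t (restr S x) = amp t x.
Proof.
elim: t x => {S} [S q eS a b x|S k w t IH x|S k P [_ _ PS] t IH x] /=.
- by rewrite mxE eS set11.
- by apply: eq_bigr => j _; rewrite IH.
apply: eq_bigr => j _; rewrite -IH restr_restr; last by rewrite -PS; apply: bigcup_sup.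
by rewrite IH.
Qed.

(** Normalization keeps supports nonempty, as [set_tree_size] demands. *)
Lemma unit_norm_support S (t : qtree R S) :
  unit_norm S (amp t) -> amp_support t != set0.
Proof.
move=> nt; apply/negP => /eqP t0; suff /eqP : (1 : CC) = 0 by rewrite oner_eq0.
rewrite -nt big1 // => x xS.
have : x \notin amp_support t by rewrite t0 in_set0.
by rewrite in_amp_support xS negbK => /eqP ->; rewrite normr0 expr0n.
Qed.

(** Manifest orthogonality turns a + gate into a disjoint union of supports; a product of amplitudes
    is nonzero exactly when all factors are, so a tensor gate becomes a tensor product of
    supports. *)
Lemma qtree_set_tree S (t : qtree R S) : normalized t ->
  manifestly_orthogonal t -> set_tree_size S (amp_support t) (leaves t).
Proof.
elim: t => {S} [S q eS a b|S k w t IH|S k P pS t IH].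
- move: eS => eS [nt _] _; have t0 := unit_norm_support nt.
  move: t0; rewrite /amp_support; subst S => t0; apply: Set_leaf => //.
  by apply/subsetP => x; rewrite in_amp_support => /andP[].
- move=> [nt nts] [dt mts]; have t0 := unit_norm_support nt.
  (* Children whose edge is labeled 0 contribute nothing to the support; they are dropped and their
     leaves become slack. *)
  pose D := [set j | w j != 0].
  have suppE : amp_support (Plus w t) = \bigcup_(j in D) amp_support (t j).
    apply/setP => x; rewrite in_amp_support /=; apply/andP/bigcupP => [[xS]|[j]].
      move=> nz; have [j] : exists j, w j * amp (t j) x != 0.
        apply/existsP; apply: contraNT nz; rewrite negb_exists => /forallP z.
        by rewrite big1 // => j _; apply/eqP; rewrite -[_ == 0]negbK.
      by rewrite mulf_eq0 negb_or => /andP[wj tj]; exists j;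
        [rewrite in_set|rewrite in_amp_support xS].
    rewrite in_set in_amp_support => wj /andP[xS tj]; split=> //.
    (* No cancellation: where child [j] has a nonzero amplitude, all the other children vanish. *)
    rewrite (bigD1 j) //= big1 ?addr0 ?mulf_neq0 // => i ij.
    by case: (dt i j ij x xS) => [->|e]; rewrite ?mulr0 // e eqxx in tj *.
  have D0 : D != set0.
    by apply: contraNneq t0 => D0; rewrite suppE D0 big_set0.
  rewrite suppE; apply: (@set_tree_weaken _ _ _ (\sum_(j in D) leaves (t j))).
    apply: set_tree_bigcup => // [j _|i j ij]; first exact: IH (nts j) (mts j).
    apply/pred0P => x /=; rewrite !in_amp_support.
    case xS: (x \in bits_on S) => //=.
    by case: (dt i j ij x xS) => ->; rewrite eqxx ?andbF.
  by rewrite /= [leqRHS](bigID (mem D)) leq_addr.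
move=> [_ nts] mts; have [P0 dP eS] := pS.
have := @set_tree_bigtensor n _ [set: 'I_k.+1] P (fun j => amp_support (t j))
  (fun j => leaves (t j)).
have -> : \bigcup_(j in [set: 'I_k.+1]) P j = S.
  by rewrite -eS; apply: eq_bigl => j; rewrite in_setT.
rewrite (eq_bigl xpredT) => [|j]; last by rewrite in_setT.
have -> : [set x in bits_on S | [forall i in [set: 'I_k.+1],
    restr (P i) x \in amp_support (t i)]] = amp_support (Tensor pS t).
  apply/setP => x; rewrite in_set in_amp_support /=; congr (_ && _).
  apply/forall_inP/prodf_neq0 => h j _.
    by have := h j (in_setT j); rewrite in_amp_support amp_restr => /andP[].
  by rewrite in_amp_support restr_on amp_restr h.
by apply=> // [|i]; [apply/set0Pn; exists ord0; rewrite in_setT|exact: IH (nts i) (mts i)].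
Qed.

Lemma sqrtC_card_neq0 X : X != set0 -> sqrtC (#|X|%:R : CC) != 0.
Proof. by rewrite sqrtC_eq0 pnatr_eq0 cards_eq0. Qed.

(** There are [#|X|] terms, each equal to the inverse of [#|X|]. A general [psi] is allowed so that
    the lemma applies to the amplitudes of any tree that represents the uniform state. *)
Lemma uniform_state_unit_norm S X (psi : bits n -> CC) :
    X != set0 -> X \subset bits_on S ->
    (forall x, x \in bits_on S -> psi x = uniform_state R X x) ->
  unit_norm S psi.
Proof.
move=> X0 XS psiE; rewrite /unit_norm.
under eq_bigr => x xS do rewrite psiE //.
rewrite (big_setID X) /= (setIidPr XS) [X in _ + X]big1 ?addr0 => [|x]; last first.
  by rewrite in_setD /uniform_state => /andP[/negPf->]; rewrite normr0 expr0n.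
under eq_bigr => x xX do rewrite /uniform_state xX.
rewrite sumr_const normfV exprVn -normrX sqrtCK normr_nat -[LHS]mulr_natl mulfV //.
by rewrite pnatr_eq0 cards_eq0.
Qed.

Lemma bits_on1P q x : x \in bits_on [set q] ->
  x = if x q 0 == 0 then 0 else delta_mx q 0.
Proof.
move=> /bits_onP xq; apply/matrixP => i j; rewrite (ord1 j).
have [->|iq] := eqVneq i q; last first.
  by rewrite xq ?in_set1 //; case: ifP; rewrite !mxE ?(negPf iq).
case: ifPn => [/eqP->|]; rewrite mxE ?eqxx //.
by case: (x q 0) => [[|[|m]] lt_m] //= _; apply/val_inj.
Qed.

Lemma ord2_neq_ind (Q : 'I_2 -> 'I_2 -> Prop) :
  Q ord0 ord_max -> Q ord_max ord0 -> forall i j, i != j -> Q i j.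
Proof.
have ord2P (i : 'I_2) : i = ord0 \/ i = ord_max.
  by case: i => [[|[|m]] lt_m] //; [left|right]; apply/val_inj.
by move=> Q01 Q10 i j; case: (ord2P i) => ->; case: (ord2P j) => ->.
Qed.

(** Each construction step is realized by a binary gate on uniform states. The inequality absorbs
    the slack at the leaves, each of which becomes a single leaf of the tree. *)
Lemma set_tree_qtree I X m : set_tree_size I X m ->
  exists2 m', (m' <= m)%N & has_mo_tree_of_size I (uniform_state R X) m'.
Proof.
move=> tX; elim: tX (set_tree_proper tX) => {I X m}.
- move=> q X m Xq X0 m0 _; exists 1%N => //.
  pose t := Leaf (erefl [set q]) (uniform_state R X 0) (uniform_state R X (delta_mx q 0)).
  have rt : represents t (uniform_state R X).
    by move=> x /bits_on1P xq; rewrite [in RHS]xq /=; case: ifP.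
  by exists t; split=> //; split=> //; apply: uniform_state_unit_norm rt.
- move=> I X Y a b dXY tX IHX tY IHY [_ XY0 XYI].
  have [_ X0 XI] := set_tree_proper tX; have [_ Y0 YI] := set_tree_proper tY.
  have [a' lea [u [nu mu ru lu]]] := IHX (set_tree_proper tX).
  have [b' leb [v [nv mv rv lv]]] := IHY (set_tree_proper tY).
  exists (a' + b')%N; first exact: leq_add.
  (* These edge labels rescale the amplitudes of the uniform states on [X] and [Y] to that of the
     uniform state on the union. *)
  pose c (Z : {set bits n}) : CC := sqrtC #|Z|%:R / sqrtC #|X :|: Y|%:R.
  pose t := Plus (fun j : 'I_2 => if j == ord0 then c X else c Y)
    (fun j => if j == ord0 then u else v).
  have rt : represents t (uniform_state R (X :|: Y)).
    move=> x xI; rewrite /= !big_ord_recl big_ord0 addr0 /= ru // rv //.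
    rewrite /uniform_state in_setU /c.
    have [xX|xX] := boolP (x \in X).
      by rewrite (disjointFr dXY xX) mulr0 addr0 mulrAC mulfV ?mul1r ?sqrtC_card_neq0.
    have [xY|xY] := boolP (x \in Y); last by rewrite !mulr0 addr0.
    by rewrite mulr0 add0r mulrAC mulfV ?mul1r ?sqrtC_card_neq0.
  exists t; split=> //.
  + split; first exact: uniform_state_unit_norm rt.
    by move=> j; case: ifP.
  + split; last by move=> j; case: ifP.
    have uv x : x \in bits_on I -> amp u x = 0 \/ amp v x = 0.
      move=> xI; rewrite ru // rv // /uniform_state.
      by case: ifP => [/(disjointFr dXY)->|_]; [right|left].
    by apply: ord2_neq_ind => //= x /uv[]; [right|left].
  by rewrite /= !big_ord_recl big_ord0 addn0 /= lu lv.
move=> I J X Y a b dIJ tX IHX tY IHY [_ T0 TU].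
have [I0 X0 XI] := set_tree_proper tX; have [J0 Y0 YJ] := set_tree_proper tY.
have [a' lea [u [nu mu ru lu]]] := IHX (set_tree_proper tX).
have [b' leb [v [nv mv rv lv]]] := IHY (set_tree_proper tY).
exists (a' + b')%N; first exact: leq_add.
pose P (j : 'I_2) := if j == ord0 then I else J.
have pIJ : Defs.indexed_partition P (I :|: J).
  split; last by rewrite !big_ord_recl big_ord0 /P /= setU0.
    by move=> j; rewrite /P; case: ifP.
  by apply: ord2_neq_ind; rewrite /P //= disjoint_sym.
(* The dependent match lets the type [qtree R (P j)] follow the test [j == ord0]. *)
pose s (j : 'I_2) : qtree R (P j) :=
  match j == ord0 as c return qtree R (if c then I else J) with
  | true => u | false => v end.
have rt : represents (Tensor pIJ s) (uniform_state R (tensor_set I J X Y)).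
  move=> x xU; rewrite /= !big_ord_recl big_ord0 mulr1 /s /=.
  rewrite -(amp_restr u) -(amp_restr v) ru ?restr_on // rv ?restr_on //.
  rewrite /uniform_state in_tensor xU card_tensor //=.
  case: ifP => _ /=; last by rewrite mul0r.
  case: ifP => _ /=; last by rewrite mulr0.
  by rewrite natrM rootCMl ?ler0n // invfM.
exists (Tensor pIJ s); split=> //.
- split; first exact: uniform_state_unit_norm rt.
  by move=> j; rewrite /s /P; case: (j == ord0).
- by move=> j; rewrite /s /P; case: (j == ord0).
by rewrite /= !big_ord_recl big_ord0 addn0 /s /= lu lv.
Qed.

Lemma M_set_tree I X : I != set0 -> X != set0 -> X \subset bits_on I ->
  set_tree_size I X (M R I X) /\ forall m, set_tree_size I X m -> (M R I X <= m)%N.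
Proof.
move=> I0 X0 XI; rewrite /M /MOTS; case: pselect => [ex|nex]; last first.
  have [m tX] := set_tree_exists I0 X0 XI; have [m' _ h] := set_tree_qtree tX.
  by case: nex; exists m'; apply/asboolP.
case: ex_minnP => m /asboolP[t [nt mt rt <-]] mmin; split; last first.
  move=> c /set_tree_qtree[c' lec h]; apply: leq_trans lec.
  by apply: mmin; apply/asboolP.
(* An optimal tree for the uniform state on [X] has support [X], so its supports give a construction
   of exactly that size. *)
suff <- : amp_support t = X by apply: qtree_set_tree.
apply/setP => x; rewrite in_amp_support.
have [xI|xI] := boolP (x \in bits_on I); last first.
  by apply/esym/negbTE; apply: contra xI; apply: (subsetP XI).
by rewrite rt // /uniform_state; case: ifP; rewrite ?eqxx // invr_eq0 sqrtC_card_neq0.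
Qed.
End Trees.

(** * Cosets, their fibers and their decompositions *)

Section Cosets.
Variable n : nat.
Implicit Types (I J : {set 'I_n}) (x y z : bits n) (C X : {set bits n}).

Lemma coset_sub I C : is_coset I C -> C \subset bits_on I.
Proof. by case=> _ [k [A [b ->]]]; apply: subsetIl. Qed.

Lemma coset_affine I C x y z : is_coset I C ->
  x \in C -> y \in C -> z \in C -> x - y + z \in C.
Proof.
case=> _ [k [A [b ->]]]; rewrite ![_ \in _ :&: _]in_setI.
move=> /andP[xI xA] /andP[yI yA] /andP[zI zA].
rewrite bits_onD ?bits_onB //=; move: xA yA zA; rewrite !in_set => /eqP xA /eqP yA /eqP zA.
by rewrite mulmxDr mulmxBr xA yA zA subrK.
Qed.

(** The slice of [C] obtained by freezing the [J]-coordinates to those of [x]. For a coset [C]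
    containing [x], it is the component of the decomposition over [I] that contains [restr I x]. *)
Definition fiber I J C x : {set bits n} :=
  [set y in bits_on I | y + restr J x \in C].

Lemma in_fiber I J C x y :
  (y \in fiber I J C x) = (y \in bits_on I) && (y + restr J x \in C).
Proof. by rewrite in_set. Qed.

Lemma restrU_id I J x : [disjoint I & J] -> x \in bits_on (I :|: J) ->
  restr I x + restr J x = x.
Proof. by move=> dIJ xU; rewrite -restrU // restr_id. Qed.

Section Fibers.
Variables (I J : {set 'I_n}) (C : {set bits n}).
Hypotheses (dIJ : [disjoint I & J]) (cC : is_coset (I :|: J) C).

Lemma coset_restrU x : x \in C -> restr I x + restr J x = x.
Proof. by move=> /(subsetP (coset_sub cC)); apply: restrU_id. Qed.

Lemma restr_in_fiber x : x \in C -> restr I x \in fiber I J C x.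
Proof. by move=> xC; rewrite in_fiber restr_on coset_restrU. Qed.

Lemma fiber_coset x : x \in C -> is_coset I (fiber I J C x).
Proof.
move=> xC; split; first by apply/set0Pn; exists (restr I x); apply: restr_in_fiber.
case: cC => _ [k [A [b eC]]]; exists k, A, (b - A *m restr J x).
apply/setP => y; rewrite in_fiber in_setI; case yI: (y \in bits_on I) => //=.
rewrite eC in_setI onU_add ?restr_on //= [LHS]in_set [RHS]in_set mulmxDr.
by rewrite -subr_eq0 -[RHS]subr_eq0 opprB addrA.
Qed.

(** Write x_I, x_J for the restrictions. Affine closure applied to z + x_J, y + x_J, y + x'_J yields
    z + x'_J, which is the first inclusion. *)
Lemma fiber_subset x x' y : x \in C -> x' \in C ->
    y \in fiber I J C x -> y \in fiber I J C x' ->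
  fiber I J C x \subset fiber I J C x' /\ fiber J I C x \subset fiber J I C x'.
Proof.
move=> xC xC'; rewrite !in_fiber => /andP[_ yx] /andP[_ yx'].
have aff := coset_affine cC.
split; apply/subsetP => z; rewrite !in_fiber => /andP[-> zx] /=.
  by have := aff _ _ _ zx yx yx'; rewrite [y + restr J x]addrC addrKA subrKA.
(* The inner combination x' - (y + x'_J) + (y + x_J) is x'_I + x_J; then (z + x_I) - x + (x'_I +
   x_J) is z + x'_I. *)
have := aff _ _ _ zx xC (aff _ _ _ xC' yx' yx).
rewrite -[X in _ - X + _](coset_restrU xC) -[X in X - (y + _)](coset_restrU xC').
by rewrite [y + restr J x']addrC !addrKA subrKA [restr I x' + _]addrC subrKA.
Qed.

Lemma fiber_eq x x' y : x \in C -> x' \in C ->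
    y \in fiber I J C x -> y \in fiber I J C x' ->
  fiber I J C x = fiber I J C x' /\ fiber J I C x = fiber J I C x'.
Proof.
move=> xC xC' yx yx'; have [sI sJ] := fiber_subset xC xC' yx yx'.
have [sI' sJ'] := fiber_subset xC' xC yx' yx.
by split; apply/eqP; rewrite eqEsubset ?sI ?sI' ?sJ ?sJ'.
Qed.

(** Affine closure: (z + x'_J) - x' + x equals z + (x_I - x'_I) + x_J, and the roles of x and x' can
    be exchanged. *)
Lemma fiber_translate x x' : x \in C -> x' \in C ->
  fiber I J C x' = [set y | y + (restr I x - restr I x') \in fiber I J C x].
Proof.
have aff := coset_affine cC.
suff sub u u' z : u \in C -> u' \in C -> z \in bits_on I ->
    z + restr J u' \in C -> z + (restr I u - restr I u') + restr J u \in C.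
  move=> xC xC'; apply/setP => y; rewrite [RHS]in_set !in_fiber.
  apply/andP/andP => [[yI yx']|[yI yx]].
    by rewrite sub // bits_onD // bits_onB ?restr_on.
  have yI' : y \in bits_on I.
    by rewrite -[y](addrK (restr I x - restr I x')) bits_onB // bits_onB ?restr_on.
  split=> //; have := sub _ _ _ xC' xC yI yx.
  by rewrite -[_ - restr I x]opprB addrK.
move=> uC uC' _ zu'; have := aff _ _ _ zu' uC' uC.
rewrite -[X in _ - X + _](coset_restrU uC') -[X in _ + X](coset_restrU uC).
rewrite [restr I u' + _]addrC addrKA addrA.
by rewrite [z + (_ - _)]addrA [z + _ - _]addrAC.
Qed.
End Fibers.

Lemma coset_decomposition_sym C I J H (CI CJ : 'I_H -> {set bits n}) :
  coset_decomposition C I J CI CJ -> coset_decomposition C J I CJ CI.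
Proof.
move=> [cIJ dI dJ eC]; split=> // [h|]; first by case: (cIJ h).
by rewrite eC; apply: eq_bigr => h _; rewrite tensor_setC.
Qed.

(** The components of any decomposition are forced to be fibers, which gives their uniqueness. *)
Lemma decomposition_fiber C I J H (CI CJ : 'I_H -> {set bits n}) g x :
    [disjoint I & J] -> coset_decomposition C I J CI CJ ->
    x \in tensor_set I J (CI g) (CJ g) ->
  CI g = fiber I J C x.
Proof.
move=> dIJ [cIJ dI dJ eC]; rewrite in_tensor => /and3P[xU xI xJ].
have [/coset_sub/subsetP sI _] := cIJ g.
apply/setP => y; rewrite in_fiber; apply/idP/andP => [yg|[yI]].
  split; first exact: sI.
  by rewrite eC; apply/bigcupP; exists g => //; rewrite mem_tensorD ?restr_on ?yg ?sI.
rewrite eC => /bigcupP[g' _]; rewrite mem_tensorD ?restr_on // => /andP[yg' xg'].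
have [->//|/dJ dgg'] := eqVneq g g'.
by rewrite (disjointFr dgg' xJ) in xg'.
Qed.

Lemma decomposition_mem C I J H (CI CJ : 'I_H -> {set bits n}) g :
    [disjoint I & J] -> coset_decomposition C I J CI CJ ->
  exists x, x \in C /\ x \in tensor_set I J (CI g) (CJ g).
Proof.
move=> dIJ [cIJ _ _ eC]; have [cI cJ] := cIJ g.
case: (cI) (cJ) => /set0Pn[y yg] _ [/set0Pn[z zg] _].
have xg : y + z \in tensor_set I J (CI g) (CJ g).
  rewrite mem_tensorD ?yg //; [exact: subsetP (coset_sub cI) _ yg|].
  exact: subsetP (coset_sub cJ) _ zg.
by exists (y + z); split=> //; rewrite eC; apply/bigcupP; exists g.
Qed.

(** Both components are fibers of the same coset, hence translates. This is why cardinality and [M]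
    do not depend on the index. *)
Lemma decomposition_translate C I J H (CI CJ : 'I_H -> {set bits n}) g g' :
    [disjoint I & J] -> is_coset (I :|: J) C -> coset_decomposition C I J CI CJ ->
  exists2 t, t \in bits_on I & CI g' = [set y | y + t \in CI g].
Proof.
move=> dIJ cC dC; have [x [xC xg]] := decomposition_mem g dIJ dC.
have [x' [xC' xg']] := decomposition_mem g' dIJ dC.
exists (restr I x - restr I x'); first by rewrite bits_onB ?restr_on.
by rewrite (decomposition_fiber dIJ dC xg) (decomposition_fiber dIJ dC xg') -fiber_translate.
Qed.

Lemma card_translate X t : #|[set y | y + t \in X]| = #|X|.
Proof. exact: (card_preimset X (addIr t)). Qed.

Lemma fiber_decomposition I J C : [disjoint I & J] -> is_coset (I :|: J) C ->
  exists H (CI CJ : 'I_H -> {set bits n}), coset_decomposition C I J CI CJ /\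
    forall x, x \in C -> exists h, CI h = fiber I J C x /\ CJ h = fiber J I C x.
Proof.
move=> dIJ cC; have cC' := cC; rewrite setUC in cC'.
have dJI : [disjoint J & I] by rewrite disjoint_sym.
(* Forming a set of pairs merges the points with equal fibers, so distinct indices carry distinct
   pairs and, by [fiber_eq], disjoint components. *)
pose D := [set (fiber I J C x, fiber J I C x) | x in C].
have pairP (h : 'I_#|D|) : exists2 x, x \in C &
    enum_val h = (fiber I J C x, fiber J I C x) by apply/imsetP/enum_valP.
have fiber_pair x : x \in C -> exists h : 'I_#|D|, enum_val h = (fiber I J C x, fiber J I C x).
  move=> xC; have xD : (fiber I J C x, fiber J I C x) \in D by apply: imset_f.
  by exists (enum_rank_in xD (fiber I J C x, fiber J I C x)); rewrite enum_rankK_in.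
exists #|D|, (fun h => (enum_val h).1), (fun h => (enum_val h).2); split; last first.
  by move=> x /fiber_pair[h e]; exists h; rewrite /= e.
split=> [h|h h' hh'|h h' hh'|].
- by have [x xC e] := pairP h; rewrite /= e; split; apply: fiber_coset.
- have [x xC e] := pairP h; have [x' xC' e'] := pairP h'.
  apply/pred0P => y /=; apply/negbTE; apply: contra hh' => /andP[].
  rewrite e e' /= => yx yx'; have [eI eJ] := fiber_eq dIJ cC xC xC' yx yx'.
  by apply/eqP/enum_val_inj; rewrite e e' eI eJ.
- have [x xC e] := pairP h; have [x' xC' e'] := pairP h'.
  apply/pred0P => y /=; apply/negbTE; apply: contra hh' => /andP[].
  rewrite e e' /= => yx yx'; have [eI eJ] := fiber_eq dJI cC' xC xC' yx yx'.
  by apply/eqP/enum_val_inj; rewrite e e' eI eJ.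
apply/setP => x; apply/idP/bigcupP => [xC|[h _ /=]].
  have [h e] := fiber_pair x xC; exists h => //=; rewrite e /= in_tensor.
  by rewrite (subsetP (coset_sub cC)) //= !restr_in_fiber.
have [u uC ->] := pairP h; rewrite in_tensor !in_fiber => /and3P[xU].
(* With [u] a point defining the pair, (x_I + u_J) - u + (x_J + u_I) = x_I + x_J = x. *)
move=> /andP[_ xI] /andP[_ xJ]; have := coset_affine cC xI uC xJ.
rewrite -[X in _ - X + _](coset_restrU dIJ cC uC).
by rewrite [restr I u + _]addrC addrKA [restr J x + _]addrC subrKA restrU_id.
Qed.
End Cosets.

(** * Upper and lower bounds on the construction size of cosets *)

Section MinimumSize.
Variables (R : realType) (n : nat).
Implicit Types (I J K : {set 'I_n}) (C X : {set bits n}).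

Lemma coset_card_neq0 I C : is_coset I C -> #|C|%:R != 0 :> R.
Proof. by case=> C0 _; rewrite pnatr_eq0 cards_eq0. Qed.

Lemma M_coset_set_tree I C : I != set0 -> is_coset I C ->
  set_tree_size I C (M R I C) /\ forall m, set_tree_size I C m -> (M R I C <= m)%N.
Proof. by move=> I0 cC; apply: M_set_tree => //; [case: cC|apply: coset_sub]. Qed.

Lemma decomposition_M_le C I J H (CI CJ : 'I_H -> {set bits n}) h :
    I != set0 -> J != set0 -> [disjoint I & J] -> is_coset (I :|: J) C ->
    coset_decomposition C I J CI CJ ->
  (M R (I :|: J) C <= H * (M R I (CI h) + M R J (CJ h)))%N /\
  #|C| = (H * (#|CI h| * #|CJ h|))%N.
Proof.
move=> I0 J0 dIJ cC dC; have [cIJ dI dJ eC] := dC.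
have dJI : [disjoint J & I] by rewrite disjoint_sym.
have cC' := cC; rewrite setUC in cC'.
have dC' := coset_decomposition_sym dC.
pose F g := tensor_set I J (CI g) (CJ g).
have dF g g' : g != g' -> [disjoint F g & F g'].
  move=> gg'; apply/pred0P => x; rewrite /= !in_tensor.
  by apply/negbTE/andP => -[/and3P[_ xI _]]; rewrite (disjointFr (dI _ _ gg') xI) andbF.
have eC' : C = \bigcup_(g in [set: 'I_H]) F g.
  by rewrite eC; apply: eq_bigl => g; rewrite in_setT.
split.
  have U0 : I :|: J != set0 by rewrite setU_eq0 negb_and I0.
  have [_] := M_coset_set_tree U0 cC; apply.
  rewrite -[H in (H * _)%N]card_ord -cardsT -sum_nat_const eC'.
  apply: set_tree_bigcup => // [|g _]; first by apply/set0Pn; exists h; rewrite in_setT.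
  rewrite /F.
  have [t tI ->] := decomposition_translate h g dIJ cC dC.
  have [s sJ ->] := decomposition_translate h g dJI cC' dC'.
  have [cI cJ] := cIJ h.
  have [tCI _] := M_coset_set_tree I0 cI; have [tCJ _] := M_coset_set_tree J0 cJ.
  by apply: Set_tensor => //; apply: set_tree_translate.
rewrite eC -sum1_card partition_disjoint_bigcup //=.
rewrite (eq_bigr (fun=> #|CI h| * #|CJ h|)%N) => [|g _].
  by rewrite sum_nat_const card_ord.
have [/coset_sub sI /coset_sub sJ] := cIJ g.
rewrite sum1_card card_tensor //.
have [t tI ->] := decomposition_translate h g dIJ cC dC.
have [s sJ' ->] := decomposition_translate h g dJI cC' dC'.
by rewrite !card_translate.
Qed.

Lemma decomposition_density C I J H (CI CJ : 'I_H -> {set bits n}) h :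
    I != set0 -> J != set0 -> [disjoint I & J] -> is_coset (I :|: J) C ->
    coset_decomposition C I J CI CJ ->
  (M R (I :|: J) C)%:R / #|C|%:R * (#|CI h|%:R * #|CJ h|%:R) <=
    (M R I (CI h) + M R J (CJ h))%:R :> R.
Proof.
move=> I0 J0 dIJ cC dC; have [leM eC] := decomposition_M_le h I0 J0 dIJ cC dC.
have C0 : 0 < #|C|%:R :> R by rewrite lt0r (coset_card_neq0 cC) ler0n.
rewrite -mulrA [_^-1 * _]mulrC mulrA ler_pdivrMr // eC -!natrM ler_nat.
by rewrite [leqRHS]mulnA [(_ * H)%N]mulnC leq_mul2r leM orbT.
Qed.

(** Here [phi] is a guaranteed number of leaves per string. The middle clause serves one-qubit
    leaves; the last one compares [phi] with every ratio, with denominators cleared and a point [x]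
    of [C] selecting the component. *)
Definition density_bound I C (phi : R) : Prop :=
  [/\ 0 <= phi,
      (#|I| <= 1)%N -> phi * #|C|%:R <= 1
    & forall J K x, J != set0 -> K != set0 -> [disjoint J & K] -> I = J :|: K ->
        x \in C -> phi * (#|fiber J K C x|%:R * #|fiber K J C x|%:R) <=
          (M R J (fiber J K C x) + M R K (fiber K J C x))%:R].

Lemma coset_density_bound I C : I != set0 -> is_coset I C ->
  density_bound I C ((M R I C)%:R / #|C|%:R).
Proof.
move=> I0 cC; have C0 := coset_card_neq0 cC; split=> [|I1|J K x J0 K0 dJK eI xC].
- by rewrite divr_ge0 ?ler0n.
- rewrite divfK // lern1.
  have /cards1P[q eI] : #|I| == 1%N by rewrite eqn_leq I1 card_gt0.
  (* On one qubit a single leaf suffices, so [M R I C] is at most 1. *)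
  have [_] := M_coset_set_tree I0 cC; apply; rewrite eI.
  by apply: Set_leaf => //; [rewrite -eI; apply: coset_sub|case: cC].
have cC' := cC; rewrite eI in cC'.
have [H [CI [CJ [dC /(_ x xC)[h [<- <-]]]]]] := fiber_decomposition dJK cC'.
by rewrite {1}eI; apply: decomposition_density.
Qed.

(** The induction generalizes over [C] and [phi], since a tensor product passes to the fibers of
    [C], each with its own density. *)
Lemma set_tree_lower I X m C phi : set_tree_size I X m -> is_coset I C ->
  X \subset C -> density_bound I C phi -> phi * #|X|%:R <= m%:R.
Proof.
move=> tX; elim: tX C phi => {I X m}
  [q X m _ _ m0|I X Y a b dXY _ IHX _ IHY|J K X Y a b dJK tX IHX tY IHY] C phi cC.
- move=> XC [phi0 + _]; rewrite cards1 => /(_ isT) phi1.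
  apply: (@le_trans _ _ (phi * #|C|%:R)).
    by rewrite ler_wpM2l // ler_nat subset_leq_card.
  by apply: le_trans phi1 _; rewrite ler1n.
- rewrite subUset => /andP[XC YC] phiC.
  rewrite cardsU disjoint_setI0 // cards0 subn0 !natrD mulrDr.
  by rewrite lerD ?(IHX C) ?(IHY C).
move=> XYC [phi0 _ phiC].
have dKJ : [disjoint K & J] by rewrite disjoint_sym.
have [J0 X0 XJ] := set_tree_proper tX; have [K0 Y0 YK] := set_tree_proper tY.
(* One point of the product fixes the pair of fibers: freezing either half at [y] or [z] puts [X]
   and [Y] inside the fibers of [x = y + z]. *)
have [/set0Pn[y yX] /set0Pn[z zY]] := (X0, Y0).
have mem u v : u \in X -> v \in Y -> u + v \in C.
  move=> uX vY; apply: (subsetP XYC).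
  by rewrite mem_tensorD ?uX // ?(subsetP XJ) ?(subsetP YK).
have xC := mem y z yX zY; set x := y + z in xC.
have [xJ xK] := restrD dJK (subsetP XJ _ yX) (subsetP YK _ zY).
have XF : X \subset fiber J K C x.
  by apply/subsetP => u uX; rewrite in_fiber (subsetP XJ) // xK mem.
have YF : Y \subset fiber K J C x.
  by apply/subsetP => v vY; rewrite in_fiber (subsetP YK) // xJ addrC mem.
have cC' := cC; rewrite setUC in cC'.
have cF := fiber_coset dJK cC xC; have cG := fiber_coset dKJ cC' xC.
have := IHX _ _ cF XF (coset_density_bound J0 cF).
have := IHY _ _ cG YF (coset_density_bound K0 cG).
have := phiC J K x J0 K0 dJK erefl xC.
move: XF YF cF cG; set F := fiber J K C x; set G := fiber K J C x => XF YF cF cG.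
have F0 := coset_card_neq0 cF; have G0 := coset_card_neq0 cG.
have p1 : #|X|%:R / #|F|%:R <= 1 :> R.
  by rewrite ler_pdivrMr ?lt0r ?F0 ?ler0n // mul1r ler_nat subset_leq_card.
have q1 : #|Y|%:R / #|G|%:R <= 1 :> R.
  by rewrite ler_pdivrMr ?lt0r ?G0 ?ler0n // mul1r ler_nat subset_leq_card.
set p := #|X|%:R / _ in p1; set q := #|Y|%:R / _ in q1.
have p0 : 0 <= p by rewrite divr_ge0.
have q0 : 0 <= q by rewrite divr_ge0.
rewrite card_tensor // natrM natrD.
have eX : #|X|%:R = p * #|F|%:R by rewrite divfK.
have eY : #|Y|%:R = q * #|G|%:R by rewrite divfK.
rewrite -!mulrA [#|F|%:R^-1 * _]mulrC [#|G|%:R^-1 * _]mulrC -/p -/q => hF hb ha.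
rewrite eX eY mulrACA [phi * _]mulrCA.
(* The ratio bound is scaled by [p * q]; the factor [q], then [p], is dropped from the respective
   summand because it is at most 1. *)
apply: le_trans (ler_wpM2l (mulr_ge0 p0 q0) hF) _.
rewrite mulrDr natrD lerD //.
  by apply: le_trans ha; rewrite mulrC ler_wpM2l ?ler0n // ler_piMr.
by apply: le_trans hb; rewrite mulrC ler_wpM2l ?ler0n // ler_piMl.
Qed.
End MinimumSize.

(** * The minimum over partitions *)

Theorem theorem29 (R : realType) (n k : nat)
    (A : 'M['F_2]_(k, n)) (b : 'cV['F_2]_k) (C : {set bits n})
    (hn : (2 <= n)%N) (hC : C = solutions A b) (hC0 : C != set0) :
  exists v : R, is_minimum (partition_ratio C) v /\
    (M R [set: 'I_n] C)%:R = #|C|%:R * v.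
Proof.
have cC : is_coset setT C.
  by split=> //; exists k, A, b; rewrite bits_onT setTI.
have C0 : 0 < #|C|%:R :> R by rewrite ltr0n card_gt0.
have upper (u : R) : partition_ratio C u -> (M R setT C)%:R <= #|C|%:R * u.
  move=> [I [J [H [CI [CJ [h [[I0 J0 dIJ IJ] dC ->]]]]]]].
  have := @decomposition_density R n C I J H CI CJ h I0 J0 dIJ.
  rewrite IJ => /(_ cC dC) le_dens; case: dC => /(_ h)[[CI0 _] [CJ0 _]] _ _ _.
  rewrite [_ * (_ / _)]mulrC -ler_pdivrMr // ler_pdivlMr //.
  by rewrite -natrM ltr0n muln_gt0 !card_gt0 CI0.
(* Triples (I, J, x) form a finite type, and the fibers of [x] make the ratio a function on it, so a
   minimizer exists. *)
pose P (u : {set 'I_n} * {set 'I_n} * bits n) :=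
  [&& u.1.1 != set0, u.1.2 != set0, [disjoint u.1.1 & u.1.2],
      u.1.1 :|: u.1.2 == setT & u.2 \in C].
pose F (u : {set 'I_n} * {set 'I_n} * bits n) : R :=
  (M R u.1.1 (fiber u.1.1 u.1.2 C u.2) + M R u.1.2 (fiber u.1.2 u.1.1 C u.2))%:R
  / (#|fiber u.1.1 u.1.2 C u.2|%:R * #|fiber u.1.2 u.1.1 C u.2|%:R).
have [x0 x0C] := set0Pn _ hC0.
pose i0 : 'I_n := Ordinal (ltnW hn); pose i1 : 'I_n := Ordinal hn.
(* A nontrivial partition exists because [n] is at least 2: the complement of [i0] contains [i1]. *)
have P0 : P ([set i0], ~: [set i0], x0).
  rewrite /P /= setUCr eqxx x0C -!card_gt0 cards1 !andbT -setI_eq0 setICr eqxx andbT.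
  by apply/card_gt0P; exists i1; rewrite !inE.
case: (arg_minP F P0) => -[[I J] x] /and5P[/= I0 J0 dIJ /eqP IJ xC] Fmin.
have ratioF : partition_ratio C (F (I, J, x)).
  have cC' := cC; rewrite -IJ in cC'.
  have [H [CI [CJ [dC /(_ x xC)[h [eI eJ]]]]]] := fiber_decomposition dIJ cC'.
  by exists I, J, H, CI, CJ, h; split=> //; rewrite eI eJ.
have eM : (M R setT C)%:R = #|C|%:R * F (I, J, x).
  apply/eqP; rewrite eq_le upper //= mulrC.
  have T0 : [set: 'I_n] != set0 by apply/set0Pn; exists i0; rewrite in_setT.
  have [tC _] := M_coset_set_tree R T0 cC.
  apply: (set_tree_lower tC cC (subxx _)); split.
  - by rewrite divr_ge0 // mulr_ge0.
  (* The one-qubit clause is vacuous for the full index set, as [n] is at least 2. *)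
  - by rewrite cardsT card_ord leqNgt hn.
  move=> J' K' y J0' K0' dJK' eJK yC.
  have cC' := cC; rewrite eJK in cC'.
  have dKJ' : [disjoint K' & J'] by rewrite disjoint_sym.
  have cC'' := cC'; rewrite setUC in cC''.
  rewrite -ler_pdivlMr.
    by apply: (Fmin (J', K', y)); rewrite /P /= J0' K0' dJK' -eJK eqxx.
  rewrite -natrM ltr0n muln_gt0 !card_gt0.
  by case: (fiber_coset dJK' cC' yC) (fiber_coset dKJ' cC'' yC) => -> _ [].
(* Minimality among all decompositions follows from the upper bound: [#|C| * F (I, J, x)] equals
   [M], which is at most [#|C| * u] for every ratio [u]. *)
exists (F (I, J, x)); split=> //; split=> // u /upper.
by rewrite eM ler_pM2l.
Qed.
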